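(* Let $m$ be a positive integer and $\lambda$ a nonzero real number. For integers $n\ge k\ge0$, $$V_{m,\lambda}(n,k)=\sum_{i=k}^{n}\sum_{j=k}^{i}\sum_{l=k}^{j}\binom{n}{i}m^{i-j}S_{1,\lambda}(l,k)S_{2}(j,l)S_{1}(i,j)\,V_{m,\lambda}(n-i,0).$$
   Context: For a nonzero real $\lambda$: $(x)_{0,\lambda}=1$, $(x)_{n,\lambda}=x(x-\lambda)\cdots(x-(n-1)\lambda)$; $(x)_n=(x)_{n,1}$. Stirling numbers: $(x)_n=\sum_k S_1(n,k)x^k$, $x^n=\sum_k S_2(n,k)(x)_k$. Degenerate Stirling numbers of the first kind: $(x)_n=\sum_{l=0}^{n}S_{1,\lambda}(n,l)(x)_{l,\lambda}$. Degenerate Whitney numbers of the first kind $V_{m,\lambda}(n,k)$: $m^{n}(x)_{n}=\sum_{k=0}^{n}V_{m,\lambda}(n,k)(mx+1)_{k,\lambda}$ (so $V_{m,\lambda}(p,0)=m^p(-1/m)_p$). *)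

(* Defs.v *)
From HB Require Import structures.
From mathcomp Require Import all_boot all_order all_algebra.
From mathcomp Require Import boolp classical_sets reals.

Set Implicit Arguments.
Unset Strict Implicit.
Unset Printing Implicit Defensive.

Import Order.TTheory GRing.Theory Num.Theory.
Local Open Scope ring_scope.

(* The degenerate falling factorial (x)_{n,lam}. *)
Definition dfact (R : realType) (lam x : R) (n : nat) : R :=
  \prod_(i < n) (x - i%:R * lam).

Definition fallfact (R : realType) (x : R) (n : nat) : R := dfact 1 x n.

(* [c] gives the coefficients of the functions [p n] along [b 0, ..., b n].
   The identity for [p n] says nothing about [c n k] with [n < k]; these entries
   are set to 0, which makes [c] unique (lemma [expansion_uniq]). *)
Definition is_expansion (R : realType) (p b : nat -> R -> R)
    (c : nat -> nat -> R) : Prop :=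
  (forall n x, p n x = \sum_(k < n.+1) c n k * b k x) /\
  (forall n k, (n < k)%N -> c n k = 0).

(* The unique expansion of [p] along [b]; the default value 0 is irrelevant in
   the four uses below (for [dwhitney1], when [0 < m]): see [expansion_uniq]
   and [stirling1P], [stirling2P], [dstirling1P], [dwhitney1P]. *)
Definition expansion (R : realType) (p b : nat -> R -> R) : nat -> nat -> R :=
  xget (fun _ _ => 0) [set c | is_expansion p b c]%classic.

Definition stirling1 (R : realType) : nat -> nat -> R :=
  expansion (fun n x => fallfact x n) (fun k x => x ^+ k).

Definition stirling2 (R : realType) : nat -> nat -> R :=
  expansion (fun n x => x ^+ n) (fun k x => fallfact x k).

Definition dstirling1 (R : realType) (lam : R) : nat -> nat -> R :=
  expansion (fun n x => fallfact x n) (fun l x => dfact lam x l).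

Definition dwhitney1 (R : realType) (m : nat) (lam : R) : nat -> nat -> R :=
  expansion (fun n x => m%:R ^+ n * fallfact x n)
            (fun k x => dfact lam (m%:R * x + 1) k).

Lemma poly_fun0 (R : realType) (P : {poly R}) : (forall x, P.[x] = 0) -> P = 0.
Proof.
move=> P0; apply/eqP; apply: contraT => Pn0.
have := @max_poly_roots _ P [seq i%:R | i <- iota 0 (size P)] Pn0.
rewrite size_map size_iota ltnn; apply.
  by apply/allP => x _; rewrite rootE P0.
by rewrite map_inj_uniq ?iota_uniq // => i j /eqP; rewrite eqr_nat => /eqP.
Qed.

Lemma poly_expand (R : realType) (B : nat -> {poly R}) :
  (forall k, size (B k) = k.+1) -> forall n (P : {poly R}), (size P <= n)%N ->
  exists c : nat -> R, P = \sum_(k < n) c k *: B k.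
Proof.
move=> sB; elim=> [|n IHn] P sP.
  by exists (fun=> 0); rewrite big_ord0; apply/eqP; rewrite -size_poly_leq0.
pose a := P`_n / (B n)`_n.
have Bn0 : (B n)`_n != 0.
  by rewrite -[n in _`_n]/(n.+1.-1) -sB lead_coef_eq0 -size_poly_eq0 sB.
have [|c Pc] := IHn (P - a *: B n).
  apply/leq_sizeP => j; rewrite leq_eqVlt coefB coefZ => /orP[/eqP<-|nj].
    by rewrite divfK // subrr.
  by rewrite !nth_default ?mulr0 ?subrr ?sB // (leq_trans sP).
exists (fun k => if k == n then a else c k).
rewrite big_ord_recr /= eqxx -[LHS](subrK (a *: B n)) Pc; congr (_ + _).
by apply: eq_bigr => i _; rewrite ltn_eqF.
Qed.

Lemma poly_free (R : realType) (B : nat -> {poly R}) :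
  (forall k, size (B k) = k.+1) -> forall n (c : nat -> R), \sum_(k < n) c k *: B k = 0 ->
  forall k, (k < n)%N -> c k = 0.
Proof.
move=> sB; elim=> // n IHn c; rewrite big_ord_recr /= => s0.
have cn0 : c n = 0.
  move/(congr1 (fun P : {poly R} => P`_n)): s0.
  rewrite coefD coef0 coefZ coef_sum big1 ?add0r => [|i _]; last first.
    by rewrite coefZ nth_default ?mulr0 // sB.
  move/eqP; rewrite mulf_eq0 => /orP[/eqP//|].
  by rewrite -[n in _`_n]/(n.+1.-1) -sB lead_coef_eq0 -size_poly_eq0 sB.
move: s0; rewrite cn0 scale0r addr0 => /IHn c0 k.
by rewrite ltnS leq_eqVlt => /orP[/eqP->//|/c0].
Qed.

(* Here [size] is the degree plus one: [b k] is polynomial of degree exactly [k]. *)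
Definition is_graded (R : realType) (b : nat -> R -> R) : Prop :=
  exists2 B : nat -> {poly R},
    (forall k, size (B k) = k.+1) & (forall k x, b k x = (B k).[x]).

Lemma expansion_ex (R : realType) (p b : nat -> R -> R) :
  is_graded p -> is_graded b -> exists c, is_expansion p b c.
Proof.
move=> [P sP pP] [B sB bB].
have /choice[c Pc] : forall n, exists c : nat -> R,
    P n = \sum_(k < n.+1) c k *: B k.
  by move=> n; apply: poly_expand; rewrite ?sP.
exists (fun n k => if (k <= n)%N then c n k else 0); split=> [n x|n k nk].
  rewrite pP Pc horner_sum; apply: eq_bigr => k _.
  by rewrite -ltnS ltn_ord hornerZ bB.
by rewrite leqNgt nk.
Qed.

Lemma expansion_uniq (R : realType) (p b : nat -> R -> R) c d : is_graded b ->
  is_expansion p b c -> is_expansion p b d -> c = d.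
Proof.
move=> [B sB bB] [pc c0] [pd d0]; apply/funext => n; apply/funext => k.
have [nk|kn] := ltnP n k; first by rewrite c0 ?d0.
apply/eqP; rewrite -subr_eq0; apply/eqP.
apply: (poly_free sB (n := n.+1) (c := fun k => c n k - d n k)) => //.
apply: poly_fun0 => x; rewrite horner_sum.
under eq_bigr do rewrite hornerZ -bB mulrBl.
by rewrite sumrB -pc -pd subrr.
Qed.

Lemma expansionP (R : realType) (p b : nat -> R -> R) :
  is_graded p -> is_graded b -> is_expansion p b (expansion p b).
Proof. by move=> gp gb; apply: xgetPex; apply: expansion_ex. Qed.

Lemma graded_exp (R : realType) : is_graded (fun k (x : R) => x ^+ k).
Proof.
by exists (fun k => 'X^k) => [k|k x]; rewrite ?size_polyXn // hornerXn.
Qed.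

Lemma graded_dfact (R : realType) (lam a e : R) : a != 0 ->
  is_graded (fun k x => dfact lam (a * x + e) k).
Proof.
move=> a0; exists (fun k => \prod_(i < k) (a *: 'X + (e - i%:R * lam)%:P)).
  have sf d : size (a *: 'X + d%:P) = 2%N.
    by rewrite size_polyDl size_scale ?size_polyX // ltnS size_polyC leq_b1.
  move=> k; rewrite size_prod => [|i _]; last by rewrite -size_poly_eq0 sf.
  under eq_bigr do rewrite sf.
  by rewrite sum_nat_const card_ord muln2 -addnn -addSn addnK.
move=> k x; rewrite horner_prod; apply: eq_bigr => i _.
by rewrite hornerD hornerZ hornerX hornerC addrA.
Qed.

Lemma graded_dfact1 (R : realType) (lam : R) :
  is_graded (fun k x => dfact lam x k).
Proof.
have [B sB bB] := graded_dfact lam 0 (oner_neq0 R).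
by exists B => // k x; rewrite -bB mul1r addr0.
Qed.

Lemma stirling1P (R : realType) : is_expansion
  (fun n (x : R) => fallfact x n) (fun k x => x ^+ k) (@stirling1 R).
Proof. by apply: expansionP; [exact: graded_dfact1|exact: graded_exp]. Qed.

Lemma stirling2P (R : realType) : is_expansion
  (fun n (x : R) => x ^+ n) (fun k x => fallfact x k) (@stirling2 R).
Proof. by apply: expansionP; [exact: graded_exp|exact: graded_dfact1]. Qed.

Lemma dstirling1P (R : realType) (lam : R) : is_expansion
  (fun n x => fallfact x n) (fun l x => dfact lam x l) (dstirling1 lam).
Proof. by apply: expansionP; exact: graded_dfact1. Qed.

Lemma dwhitney1P (R : realType) (m : nat) (lam : R) : (0 < m)%N -> is_expansion
  (fun n x => m%:R ^+ n * fallfact x n)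
  (fun k x => dfact lam (m%:R * x + 1) k) (dwhitney1 m lam).
Proof.
move=> m0; have mn0 : m%:R != 0 :> R by rewrite pnatr_eq0 -lt0n.
apply: expansionP; last exact: graded_dfact.
have [B sB bB] := graded_dfact1 (1 : R).
exists (fun n => m%:R ^+ n *: B n) => [n|n x].
  by rewrite size_scale // expf_neq0.
by rewrite hornerZ -bB.
Qed.

(* Main.v *)
Require Import Defs.
From HB Require Import structures.
From mathcomp Require Import all_boot all_order all_algebra.
From mathcomp Require Import boolp classical_sets reals.
From mathcomp Require Import ring.

Import Order.TTheory GRing.Theory Num.Theory.
Local Open Scope ring_scope.

(** With y = m x + 1 we have m^n (x)_n = (y - 1)_{n,m}, which the Vandermonde
    identity for (.)_{n,m} expands along the (y)_{i,m}; the coefficient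
    (-1)_{n-i,m} is V_{m,lam}(n-i,0), as evaluation at y = 0 shows. The formula
    is then the composition of the changes of basis
    (y)_{i,m} -> y^j -> (y)_l -> (y)_{k,lam}. *)

Lemma dfactS (R : realType) (a x : R) (n : nat) :
  dfact a x n.+1 = dfact a x n * (x - n%:R * a).
Proof. by rewrite /dfact big_ord_recr. Qed.

Lemma dfact0S (R : realType) (a : R) (n : nat) : dfact a 0 n.+1 = 0.
Proof. by rewrite /dfact big_ord_recl mul0r subrr mul0r. Qed.

Lemma dfact_scale (R : realType) (c a x : R) (n : nat) :
  dfact (c * a) (c * x) n = c ^+ n * dfact a x n.
Proof.
rewrite /dfact -[in c ^+ n](card_ord n) -prodr_const -big_split /=.
by apply: eq_bigr => i _; rewrite mulrBr mulrCA.
Qed.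

(** Vandermonde identity, by induction on [n]: in the [i]-th term the new factor splits as
    [(y - (n - i) a) + (x - i a)], each part raising one of the two indices; Pascal's rule then
    merges the two sums. *)
Lemma dfactD (R : realType) (a x y : R) (n : nat) :
  dfact a (x + y) n =
  \sum_(i < n.+1) 'C(n, i)%:R * dfact a y (n - i) * dfact a x i.
Proof.
elim: n => [|n IHn]; first by rewrite big_ord1 /dfact !big_ord0 bin0 !mulr1.
rewrite dfactS IHn mulr_suml.
rewrite (eq_bigr (fun i : 'I_n.+1 =>
    'C(n, i)%:R * dfact a y (n.+1 - i) * dfact a x i
    + 'C(n, i)%:R * dfact a y (n - i) * dfact a x i.+1)); last first.
  move=> [i ltin] _ /=; rewrite ltnS in ltin.
  rewrite (subSn ltin) !dfactS (natrB _ ltin); ring.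
rewrite big_split /= big_ord_recl [RHS]big_ord_recl /= !bin0 -addrA.
congr (_ + _); under [RHS]eq_bigr => i _ do
  rewrite /bump /= add1n binS subSS natrD !mulrDl.
rewrite big_split /=; congr (_ + _).
(* The right-hand sum has one more term, whose coefficient is ['C(n, n.+1) = 0]. *)
by rewrite [RHS]big_ord_recr /= bin_small // !mul0r addr0.
Qed.

(** Changes of basis compose by multiplying lower triangular matrices, so the inner index only runs
    from [k] to [n]. *)
Lemma is_expansion_comp (R : realType) (p b d : nat -> R -> R) c e :
  is_expansion p b c -> is_expansion b d e ->
  is_expansion p d (fun n k => \sum_(k <= j < n.+1) c n j * e j k).
Proof.
move=> [pc c0] [be e0]; split=> [n x|n k nk]; last by rewrite big_geq.
(* The zeros of [e] above the diagonal give all the [b j] a common summation range, so that the two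
   sums can be exchanged. *)
have wide j : (j < n.+1)%N -> b j x = \sum_(k < n.+1) e j k * d k x.
  move=> jn; rewrite be (big_ord_widen _ (fun k => e j k * d k x) jn) big_mkcond.
  by apply: eq_bigr => k _; case: ltnP => // /e0->; rewrite mul0r.
rewrite pc; under eq_bigr => j _ do rewrite wide // mulr_sumr.
rewrite exchange_big /=; apply: eq_bigr => k _; rewrite mulr_suml.
rewrite (big_nat_widenl k 0) // big_mkord [RHS]big_mkcond /=.
apply: eq_bigr => j _; rewrite mulrA.
by case: leqP => // /e0->; rewrite mulr0 mul0r.
Qed.

Lemma is_expansion_precomp (R : realType) (p b : nat -> R -> R) c (f : R -> R) :
  is_expansion p b c ->
  is_expansion (fun n x => p n (f x)) (fun k x => b k (f x)) c.
Proof. by move=> [pc c0]; split=> // n x; exact: pc. Qed.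

(** Homogeneity turns [dfact a x n] into [a ^+ n] times the ordinary falling factorial at
    [x / a]. *)
Lemma dfact_expansion (R : realType) (a : R) : a != 0 ->
  is_expansion (fun n x => dfact a x n) (fun k x => x ^+ k)
    (fun n k => a ^+ (n - k) * stirling1 R n k).
Proof.
move=> a0; have [s1P s10] := stirling1P R.
split=> [n x|n k nk]; last by rewrite s10 ?mulr0.
have -> : dfact a x n = a ^+ n * fallfact (x / a) n.
  by rewrite -dfact_scale mulr1 mulrC divfK.
rewrite s1P mulr_sumr; apply: eq_bigr => -[k ltkn] _ /=; rewrite ltnS in ltkn.
by rewrite -{1}(subnK ltkn) exprD expr_div_n; field; rewrite expf_neq0.
Qed.

(** The form [+ 1 - 1] is kept so that [dfactD] can split off the shift by -1. *)
Lemma natr_fallfact (R : realType) (m n : nat) (x : R) :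
  m%:R ^+ n * fallfact x n = dfact m%:R (m%:R * x + 1 - 1) n.
Proof. by rewrite addrK -dfact_scale mulr1. Qed.

Lemma dwhitney1_0 (R : realType) (m : nat) (lam : R) (n : nat) : (0 < m)%N ->
  dwhitney1 m lam n 0 = dfact m%:R (-1) n.
Proof.
move=> m0; have [wP _] := dwhitney1P lam m0.
have mn0 : m%:R != 0 :> R by rewrite pnatr_eq0 -lt0n.
(* At this point [m x + 1] is 0, where only the term of index 0 survives. *)
have := wP n (- m%:R^-1); rewrite natr_fallfact mulrN divff // addNr add0r => ->.
rewrite big_ord_recl big1 ?addr0 /= => [|i _]; last by rewrite dfact0S mulr0.
by rewrite [dfact lam 0 0]/dfact big_ord0 mulr1.
Qed.

Theorem theorem18 (R : realType) (m : nat) (lam : R) (hm : (0 < m)%N)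
    (hlam : lam != 0) (n k : nat) (hkn : (k <= n)%N) :
  dwhitney1 m lam n k =
  \sum_(k <= i < n.+1) \sum_(k <= j < i.+1) \sum_(k <= l < j.+1)
    'C(n, i)%:R * m%:R ^+ (i - j) * dstirling1 lam l k *
    stirling2 R j l * stirling1 R i j * dwhitney1 m lam (n - i) 0.
Proof.
have mn0 : m%:R != 0 :> R by rewrite pnatr_eq0 -lt0n.
have shiftP : is_expansion (fun n (x : R) => m%:R ^+ n * fallfact x n)
    (fun i x => dfact m%:R (m%:R * x + 1) i)
    (fun n i => 'C(n, i)%:R * dwhitney1 m lam (n - i) 0).
  (* For [p < i] the truncated [p - i] is 0, so the vanishing comes from the binomial alone. *)
  split=> [p x|p i pi]; last by rewrite bin_small // mul0r.
  rewrite natr_fallfact dfactD; apply: eq_bigr => i _.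
  by rewrite dwhitney1_0.
have := is_expansion_comp _ _ _ _ _ _ (stirling2P R) (dstirling1P lam).
move=> /(is_expansion_comp _ _ _ _ _ _ (dfact_expansion _ _ mn0)).
move=> /(is_expansion_precomp _ _ _ _ (fun x => m%:R * x + 1)).
move=> /(is_expansion_comp _ _ _ _ _ _ shiftP).
(* The composite and [dwhitney1] expand the same functions along the same graded family, hence have
   equal coefficients. *)
move=> /(expansion_uniq (graded_dfact lam 1 mn0) (dwhitney1P lam hm)).
move=> /(congr1 (fun c => c n k)) ->.
apply: eq_bigr => i _; rewrite mulr_sumr; apply: eq_bigr => j _.
by rewrite !mulr_sumr; apply: eq_bigr => l _; ring.
Qed.
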